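(* Let $1<q<p$ be coprime integers and let $K(p,q,h)$ be a primitive Legendrian grid number one knot in $L(p,q)$ with associated vertical length $v$. When $h,v<\gcd(q-1,p)$, the Lagrangian projection of $K(p,q,h)$ (that is, of its representative $K_0$ with special front projection) has no crossings.
   Context: **Lens space and projections.** View $S^3=\{(r_1,\theta_1,r_2,\theta_2): r_1^2+r_2^2=1\}\subset\mathbb{C}^2$ (polar coordinates) with contact form $r_1^2d\theta_1+r_2^2d\theta_2$, and let $F_{p,q}(r_1,\theta_1,r_2,\theta_2)=(r_1,\theta_1+\frac{2\pi q}{p},r_2,\theta_2+\frac{2\pi}{p})$. Then $L(p,q)=S^3/\langle F_{p,q}\rangle$ with the induced contact form; for $0<r_1<1$ the Reeb field is $\partial_{\theta_1}+\partial_{\theta_2}$. The Heegaard torus $\Sigma$ is the image of $r_1=r_2=1/\sqrt2$; it is parametrized by $0\le\theta_1<2\pi$ (mod $2\pi$), $0\le\theta_2\le\frac{2\pi}{p}$, with $(\theta_1,0)\sim(\theta_1+\frac{2\pi q}{p},\frac{2\pi}{p})$, and is divided into boxes: Box $c$ is $\frac{2\pi c}{p}\le\theta_1\le\frac{2\pi(c+1)}{p}$, $c=0,\dots,p-1$. Knots lie in the complement of the core curves $r_1=0$ and $r_2=0$. The front projection is the projection to $\Sigma$ along $r_1$; a Legendrian knot is recovered from its front by $\frac{d\theta_2}{d\theta_1}=\frac{-r_1^2}{1-r_1^2}$. The Lagrangian projection is the map to the space of Reeb orbits of $L(p,q)$, a sphere $S^2$ with latitude $r_1\in[0,1]$ and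 azimuth $\phi=\frac pk(\theta_1-\theta_2)$ mod $2\pi$, $k=\gcd(q-1,p)$. **The special knot.** A grid number one diagram is the row of $p$ boxes with a basepoint in two of them. If the basepoints are $s$ boxes apart, $v(s)$ is the integer with $s+v(s)q\equiv 0\bmod p$, $1\le v(s)\le p-1$; put $h=s$ if $s+v(s)<p$, $h=p-s$ if $s+v(s)>p$, and $v=v(h)$ (so $h+v<p$). $K(p,q,h)$ is primitive (generates $H_1(L(p,q))$) iff $\gcd(h,p)=1$. $K(p,q,h)$ is the Legendrian isotopy class of the following special knot $K_0$. Place basepoints at the centers of Box $0$ and Box $h$; connect them by a horizontal line running right from Box $0$ with length $h$ boxes, then by a vertical line running down from Box $h$ with length $v$ boxes back to Box $0$. Add a basepoint at every box center the curve passes through, so that the curve consists of $h+v$ segments of equal length. Slide each basepoint slightly along the anti-diagonal of its box (the slope $1$ diagonal, on which $\theta_1-\theta_2$ is constant) so that the slopes of the $h+v$ straight segments are negative and strictly decrease as one moves along the curve starting rightward from Box $0$. Finally replace a small neighborhood of each basepoint by a curve interpolating smoothly and strictly monotonically between the two adjacent slopes. All perturbations are sufficiently small. This is a special front projection and $K_0$ is the Legendrian knot with this front. *)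

(* Defs.v *)
(* Classical reals of the standard library, with Coquelicot. *)
From Stdlib Require Import ssreflect Reals Arith ZArith Lra Lia.
From Coquelicot Require Import Coquelicot.

Open Scope R_scope.

Definition angle_eq (a b : R) : Prop := exists n : Z, a - b = 2 * PI * IZR n.

(** * The lens space *)

(* Polar coordinates on S^3.  The angles are real numbers, so a curve of such
   coordinates is at the same time a lift of its angular part to R^2; equality
   of the points of S^3 is [S3_eq], not Leibniz equality. *)
Record S3 := mkS3 {
  r1 : R; th1 : R; r2 : R; th2 : R;
  r1_ge0 : 0 <= r1;
  r2_ge0 : 0 <= r2;
  r12 : r1 ^ 2 + r2 ^ 2 = 1 }.

Definition S3_eq (x y : S3) : Prop :=
  r1 x = r1 y /\ r2 x = r2 y /\
  (r1 x <> 0 -> angle_eq (th1 x) (th1 y)) /\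
  (r2 x <> 0 -> angle_eq (th2 x) (th2 y)).

Definition rotate (a b : R) (x : S3) : S3 :=
  mkS3 (r1 x) (th1 x + a) (r2 x) (th2 x + b) (r1_ge0 x) (r2_ge0 x) (r12 x).

Definition F (p q : nat) : S3 -> S3 :=
  rotate (2 * PI * INR q / INR p) (2 * PI / INR p).

(* Equality of the images in L(p,q); F has order p on S^3, so natural
   exponents suffice. *)
Definition lens_eq (p q : nat) (x y : S3) : Prop :=
  exists n : nat, S3_eq (Nat.iter n (F p q) x) y.

(** * The Lagrangian projection *)

Definition reeb_flow (t : R) : S3 -> S3 := rotate t t.

(* Latitude-azimuth coordinates on S^2, with poles at latitude 0 and 1. *)
Record S2 := mkS2 { latitude : R; azimuth : R }.

Definition S2_eq (P Q : S2) : Prop :=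
  latitude P = latitude Q /\
  (0 < latitude P < 1 -> angle_eq (azimuth P) (azimuth Q)).

Definition lagrangian (p q : nat) (x : S3) : S2 :=
  mkS2 (r1 x) (INR p / INR (Nat.gcd (q - 1) p) * (th1 x - th2 x)).

Lemma iter_F p q n x :
  r1 (Nat.iter n (F p q) x) = r1 x /\ r2 (Nat.iter n (F p q) x) = r2 x /\
  th1 (Nat.iter n (F p q) x) = th1 x + INR n * (2 * PI * INR q / INR p) /\
  th2 (Nat.iter n (F p q) x) = th2 x + INR n * (2 * PI / INR p).
Proof.
induction n as [|n IH].
- simpl; repeat split; lra.
- rewrite S_INR. destruct IH as (a & b & c & d).
  change (Nat.iter (S n) (F p q) x) with (F p q (Nat.iter n (F p q) x)).
  simpl. rewrite a b c d. repeat split; lra.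
Qed.

Lemma bezout_mod (a p : nat) (n : Z) : (0 < p)%nat ->
  exists i : nat, exists w : Z, (n * Z.of_nat (Nat.gcd a p) + Z.of_nat i * Z.of_nat a = w * Z.of_nat p)%Z.
Proof.
intros hp.
assert (exists u v : Z, (u * Z.of_nat a + v * Z.of_nat p)%Z = Z.of_nat (Nat.gcd a p)) as (u & v & e).
{ destruct (Nat.gcd_bezout a p) as [(x & y & e)|(x & y & e)].
  - exists (Z.of_nat x), (- Z.of_nat y)%Z. lia.
  - exists (- Z.of_nat y)%Z, (Z.of_nat x). lia. }
set (g := Z.of_nat (Nat.gcd a p)) in *.
exists (Z.to_nat ((- n * u) mod Z.of_nat p)).
rewrite Z2Nat.id; [|apply Z.mod_pos_bound; lia].
rewrite Z.mod_eq; [|lia].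
set (k := (- n * u / Z.of_nat p)%Z).
exists (n * v - k * Z.of_nat a)%Z.
rewrite <- e. ring.
Qed.

(* Off the core curves this is the projection to the space of Reeb orbits. *)
Lemma lagrangian_reeb p q x y : (1 < q)%nat -> (0 < p)%nat -> 0 < r1 x < 1 ->
  S2_eq (lagrangian p q x) (lagrangian p q y) <->
  exists t, lens_eq p q (reeb_flow t x) y.
Proof.
intros hq hp hr.
assert (P0 : 0 < INR p) by (apply lt_0_INR; lia).
assert (G0 : 0 < INR (Nat.gcd (q-1) p)).
{ apply lt_0_INR. assert (Nat.gcd (q-1) p <> 0)%nat; [|lia]. intros e. apply Nat.gcd_eq_0_r in e. lia. }
assert (Pi := PI_RGT_0).
set (k := INR (Nat.gcd (q-1) p)) in *.
split.
- intros [e1 e2]. simpl in e1, e2. destruct (e2 hr) as [n hn]. fold k in hn.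
  destruct (bezout_mod (q-1) p (n) hp) as (i & w & e).
  set (t := th2 y - th2 x - INR i * (2 * PI / INR p)).
  exists t, i.
  destruct (iter_F p q i (reeb_flow t x)) as (i1 & i2 & i3 & i4).
  apply (f_equal IZR) in e.
  rewrite plus_IZR !mult_IZR -!INR_IZR_INZ in e. rewrite minus_INR in e; [|lia]. fold k in e. simpl (INR 1) in e.
  unfold S3_eq; rewrite i1 i2 i3 i4; simpl.
  repeat split; auto.
  + assert (h1 := r12 x). assert (h2 := r12 y). rewrite <- e1 in h2.
    assert (a1 := r2_ge0 x). assert (a2 := r2_ge0 y). nra.
  + intros _. exists w.
    assert (hn' : (th1 x - th2 x) - (th1 y - th2 y) = 2 * PI * IZR n * k / INR p).
    { rewrite <- hn. field. lra. }
    unfold t.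
    transitivity ((th1 x - th2 x) - (th1 y - th2 y) + 2 * PI / INR p * (INR i * (INR q - 1))).
    field; lra.
    rewrite hn'. transitivity (2 * PI / INR p * (IZR n * k + INR i * (INR q - 1))). field; lra.
    rewrite e. field; lra.
  + intros _. exists 0%Z. unfold t. lra.
- intros (t & i & e). destruct (iter_F p q i (reeb_flow t x)) as (i1 & i2 & i3 & i4).
  destruct e as (e1 & e2 & e3 & e4). rewrite i1 in e1, e3. rewrite i2 in e2, e4. rewrite i3 in e3. rewrite i4 in e4.
  simpl in *. split; simpl; [exact e1|]. intros _.
  destruct e3 as [n hn]; [lra|]. destruct e4 as [m hm].
  { assert (h1 := r12 x). intros z. rewrite z in h1. clear - h1 hr; nra. }
  destruct (Nat.gcd_divide_l (q-1) p) as [u hu].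
  destruct (Nat.gcd_divide_r (q-1) p) as [w hw].
  apply (f_equal INR) in hu, hw. rewrite mult_INR in hu. rewrite mult_INR in hw. rewrite minus_INR in hu; [|lia].
  fold k in hu. fold k in hw. simpl (INR 1) in hu.
  exists (Z.of_nat w * (n - m) - Z.of_nat i * Z.of_nat u)%Z.
  rewrite minus_IZR !mult_IZR minus_IZR -!INR_IZR_INZ.
  fold k.
  assert (hd : (th1 x - th2 x) - (th1 y - th2 y) = 2*PI*(IZR n - IZR m) - INR i * (2*PI/INR p) * (INR q - 1)).
  { transitivity ((2*PI*IZR n) - 2*PI*IZR m - INR i * (2*PI/INR p) * (INR q - 1)); [|ring]. rewrite <- hn, <- hm. field; lra. }
  transitivity (INR p / k * ((th1 x - th2 x) - (th1 y - th2 y))); [ring|].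
  rewrite hd hu.
  assert (W0 : INR w <> 0). { intros z. rewrite z in hw. lra. }
  rewrite hw. field. split; [lra | exact W0].
Qed.

(** * Knots in L(p,q) *)

(* A knot is given by a lift K : R -> S^3 which closes up in L(p,q) after the
   parameter T, so that it is parametrized by R / TZ. *)

(* The contact form is r1^2 dth1 + r2^2 dth2; off the core curves a Legendrian
   curve satisfies dth2/dth1 = - r1^2 / (1 - r1^2). *)
Definition legendrian (K : R -> S3) : Prop :=
  forall t, 0 < r1 (K t) < 1 /\
    Derive (fun s => th2 (K s)) t / Derive (fun s => th1 (K s)) t
      = - r1 (K t) ^ 2 / (1 - r1 (K t) ^ 2).

(* S^3 is simply connected, so H_1(L(p,q)) = pi_1(L(p,q)) is the deck group
   generated by F, and the class of a loop is the deck transformation F^m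
   relating the two ends of a lift. *)
Definition primitive_knot (p q : nat) (T : R) (K : R -> S3) : Prop :=
  exists m : nat,
    (forall t, S3_eq (K (t + T)) (Nat.iter m (F p q) (K t))) /\
    (forall n : nat, exists l : nat, forall x : S3,
       S3_eq (Nat.iter n (F p q) x) (Nat.iter (l * m) (F p q) x)).

(* A crossing is a double point of the projection of the parametrized knot. *)
Definition no_crossings (p q : nat) (T : R) (K : R -> S3) : Prop :=
  forall s t, S2_eq (lagrangian p q (K s)) (lagrangian p q (K t)) ->
    exists n : Z, s = t + IZR n * T.

(** * Grid number one diagrams *)

(* v = v(s) *)
Definition vertical (p q s v : nat) : Prop :=
  (1 <= v <= p - 1)%nat /\ Nat.divide p (s + v * q).

(* h and v are the lengths of the diagram with two basepoints s boxes apart *)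
Definition grid_one (p q h v : nat) : Prop :=
  (exists s w : nat, (1 <= s <= p - 1)%nat /\ vertical p q s w /\
     (((s + w < p)%nat /\ h = s) \/ ((s + w > p)%nat /\ h = (p - s)%nat))) /\
  vertical p q h v.

(** * The special front *)

(* Fronts are lifted to the (th1, th2)-plane, the universal cover of the
   Heegaard torus R^2 / <(2 PI, 0), (2 PI q/p, 2 PI/p)>. *)

Definition box (p : nat) : R := 2 * PI / INR p.

(* The basepoints met along the curve, for j = 0, ..., h+v: h steps to the
   right from the center of Box 0, then v steps down, the last one projecting
   to the initial one.  Basepoint j is slid by (d j, d j), along the slope 1
   diagonal. *)
Definition base_th1 (p h : nat) (d : nat -> R) (j : nat) : R :=
  box p / 2 + box p * INR (Nat.min j h) + d j.

Definition base_th2 (p h : nat) (d : nat -> R) (j : nat) : R :=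
  box p / 2 - box p * INR (j - h) + d j.

(* Slope of the segment from basepoint j to basepoint j+1. *)
Definition seg_slope (p h : nat) (d : nat -> R) (j : nat) : R :=
  (base_th2 p h d (S j) - base_th2 p h d j) /
  (base_th1 p h d (S j) - base_th1 p h d j).

Definition smooth (f : R -> R) : Prop := forall n t, ex_derive_n f n t.

(* (X, Y) is a lift of a special front with all perturbations smaller than
   eps.  It follows segment j for b j <= t <= a (S j), and is the replacement
   curve near basepoint j for a j <= t <= b j; as the curve is smooth, the
   slopes at the ends of this interval are those of the adjacent segments. *)
Definition special_front (p h v : nat) (eps T : R) (X Y : R -> R) : Prop :=
  exists (d a b : nat -> R),
    let slope t := Derive Y t / Derive X t in
    (forall j, (j <= h + v)%nat -> Rabs (d j) < eps) /\
    d (h + v)%nat = d 0%nat /\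
    (forall j, (j < h + v)%nat -> seg_slope p h d j < 0) /\
    (forall j, (S j < h + v)%nat -> seg_slope p h d (S j) < seg_slope p h d j) /\
    smooth X /\ smooth Y /\
    (forall t, 0 < Derive X t) /\
    (forall t, X (t + T) = X t + box p * INR h) /\
    (forall t, Y (t + T) = Y t - box p * INR v) /\
    a (h + v)%nat = a 0%nat + T /\
    (forall j, (j < h + v)%nat -> a j < b j < a (S j)) /\
    (forall j t, (j < h + v)%nat -> b j <= t <= a (S j) ->
       exists l, 0 <= l <= 1 /\
         X t = (1 - l) * base_th1 p h d j + l * base_th1 p h d (S j) /\
         Y t = (1 - l) * base_th2 p h d j + l * base_th2 p h d (S j)) /\
    (forall j t, (j < h + v)%nat -> a j <= t <= b j ->
       Rabs (X t - base_th1 p h d j) < eps /\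
       Rabs (Y t - base_th2 p h d j) < eps) /\
    (forall s t, a 0%nat <= s -> s < t -> t <= b 0%nat -> slope s < slope t) /\
    (forall j s t, (0 < j < h + v)%nat -> a j <= s -> s < t -> t <= b j ->
       slope t < slope s).

(* K is (a lift of) the special knot K_0. *)
Definition special_knot (p h v : nat) (eps T : R) (K : R -> S3) : Prop :=
  special_front p h v eps T (fun t => th1 (K t)) (fun t => th2 (K t)) /\
  legendrian K.

(* Main.v *)
Require Import Defs.
From Stdlib Require Import Reals Arith ZArith Lra Lia.
From Coquelicot Require Import Coquelicot.

(** The Reeb direction is the slope 1 direction of the front, so the azimuth of
    the Lagrangian projection is [th1 - th2] rescaled, with period
    [k * box p] where [k = gcd (q-1, p)].  A Legendrian front has negative
    slope, hence [th1 - th2] is strictly monotone along the knot, and over one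
    period of the knot it grows by [(h + v) * box p].

    Since [q = 1] modulo [k] and [h + v q = 0] modulo [p], the number [k]
    divides [h + v]; when [h] and [v] are both smaller than [k] this leaves
    only [h + v = k] ([grid_one_sum]).  Hence the projected knot goes around
    the sphere exactly once with strictly increasing azimuth
    ([special_knot_increasing], [special_knot_translate]), and its points are
    separated by the azimuth alone.  This holds at every scale of the
    perturbation, so any positive [eps] will do. *)

Local Open Scope R_scope.

Lemma gcd_divide_sum (p q h v : nat) :
  (1 <= q)%nat -> Nat.divide p (h + v * q) ->
  Nat.divide (Nat.gcd (q - 1) p) (h + v).
Proof.
intros hq hp.
apply (Nat.divide_add_cancel_r _ (v * (q - 1))).
- apply Nat.divide_mul_r, Nat.gcd_divide_l.
- replace (v * (q - 1) + (h + v))%nat with (h + v * q)%nat by nia.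
  exact (Nat.divide_trans _ _ _ (Nat.gcd_divide_r _ _) hp).
Qed.

(** The positive multiple [h + v] of the gcd is smaller than twice the gcd. *)
Lemma grid_one_sum (p q h v : nat) :
  (1 <= q)%nat -> grid_one p q h v ->
  (h < Nat.gcd (q - 1) p)%nat -> (v < Nat.gcd (q - 1) p)%nat ->
  (h + v = Nat.gcd (q - 1) p)%nat.
Proof.
intros hq [_ [hv1 hdiv]] hh hv.
destruct (gcd_divide_sum p q h v hq hdiv) as [c hc].
destruct c as [|[|c]]; nia.
Qed.

Lemma translate_Z (f : R -> R) (T c : R) :
  (forall t, f (t + T) = f t + c) ->
  forall (n : Z) t, f (t + IZR n * T) = f t + IZR n * c.
Proof.
intros hf; apply (Z.peano_ind (fun n => forall t, _)).
- intros t; replace (t + 0 * T) with t by ring; ring.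
- intros n IH t; rewrite succ_IZR.
  replace (t + (IZR n + 1) * T) with (t + IZR n * T + T) by ring.
  rewrite hf, IH; ring.
- intros n IH t; rewrite <- Z.sub_1_r, minus_IZR.
  assert (e := hf (t + (IZR n - 1) * T)).
  replace (t + (IZR n - 1) * T + T) with (t + IZR n * T) in e by ring.
  rewrite IH in e; lra.
Qed.

Lemma increasing_inj (f : R -> R) :
  (forall s t, s < t -> f s < f t) -> forall s t, f s = f t -> s = t.
Proof.
intros hf s t e.
destruct (Rtotal_order s t) as [l|[l|l]]; [|exact l|]; apply hf in l; lra.
Qed.

(** Negative slope means that [th2] decreases wherever [th1] increases. *)
Lemma special_knot_increasing (p h v : nat) (eps T : R) (K : R -> S3) :
  special_knot p h v eps T K ->
  forall s t, s < t -> th1 (K s) - th2 (K s) < th1 (K t) - th2 (K t).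
Proof.
intros [(d & a & b & _ & _ & _ & _ & sX & sY & X_incr & _) leg].
assert (Y_decr : forall t, Derive (fun s => th2 (K s)) t < 0).
{ intros t; destruct (leg t) as [hr e]; specialize (X_incr t).
  assert (neg : Derive (fun s => th2 (K s)) t / Derive (fun s => th1 (K s)) t < 0).
  { assert (0 < r1 (K t) ^ 2 / (1 - r1 (K t) ^ 2))
      by (apply Rdiv_lt_0_compat; nra).
    rewrite e, Rdiv_opp_l; lra. }
  replace (Derive (fun s => th2 (K s)) t) with
    (Derive (fun s => th2 (K s)) t / Derive (fun s => th1 (K s)) t
       * Derive (fun s => th1 (K s)) t) by (field; lra).
  nra. }
intros s t lst.
refine (incr_function (fun u => th1 (K u) - th2 (K u)) m_infty p_infty
  (fun u => Derive (fun w => th1 (K w)) u - Derive (fun w => th2 (K w)) u)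
  _ _ s t I lst I).
- intros x _ _.
  apply (is_derive_minus (V := R_NormedModule) (fun u => th1 (K u)));
    apply Derive_correct; [apply (sX 1%nat)|apply (sY 1%nat)].
- intros x _ _; specialize (X_incr x); specialize (Y_decr x); lra.
Qed.

Lemma special_knot_translate (p h v : nat) (eps T : R) (K : R -> S3) :
  special_knot p h v eps T K ->
  forall (n : Z) t,
    th1 (K (t + IZR n * T)) - th2 (K (t + IZR n * T))
      = th1 (K t) - th2 (K t) + IZR n * (box p * INR (h + v)).
Proof.
intros [(d & a & b & _ & _ & _ & _ & _ & _ & _ & X_per & Y_per & _) _].
apply (translate_Z (fun t => th1 (K t) - th2 (K t))).
intros t; rewrite X_per, Y_per, plus_INR; ring.
Qed.

Theorem corollary2 (p q h v : nat)
    (hq : (1 < q)%nat) (hqp : (q < p)%nat) (hcop : Nat.gcd q p = 1%nat)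
    (hgrid : grid_one p q h v)
    (hh : (h < Nat.gcd (q - 1) p)%nat) (hv : (v < Nat.gcd (q - 1) p)%nat) :
  exists eps : R, (0 < eps)%R /\
    forall (T : R) (K : R -> S3),
      special_knot p h v eps T K ->
      primitive_knot p q T K ->
      no_crossings p q T K.
Proof.
exists 1; split; [lra|].
intros T K hK _ s t [_ az].
destruct (az (proj1 (proj2 hK s))) as [n e]; cbn in e.
exists n.
apply (increasing_inj _ (special_knot_increasing _ _ _ _ _ _ hK)); cbn.
rewrite (special_knot_translate _ _ _ _ _ _ hK).
rewrite (grid_one_sum p q h v) by (assumption || lia).
assert (P0 : 0 < INR p) by (apply lt_0_INR; lia).
assert (G0 : 0 < INR (Nat.gcd (q - 1) p)) by (apply lt_0_INR; lia).
set (k := INR (Nat.gcd (q - 1) p)) in *.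
apply (Rmult_eq_reg_l (INR p / k));
  [|apply Rgt_not_eq, Rdiv_lt_0_compat; assumption].
replace (INR p / k * (th1 (K t) - th2 (K t) + IZR n * (box p * k)))
  with (INR p / k * (th1 (K t) - th2 (K t)) + 2 * PI * IZR n)
  by (unfold box; field; lra).
lra.
Qed.
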